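(* Let $n\ge 1$, let $H$ be an $n\times n$ matrix with real or complex entries, and let $k\ge 1$. Let $u_i,v_i$, $i=1,\dots,k$, be $n\times 1$ column vectors with real or complex entries. Define $\Delta_0$ to be the $n\times n$ zero matrix and $$\Delta_i=\sum_{j=1}^{i}u_jv_j^T\qquad\text{for } i=1,\dots,k.$$ Then $$\det\left(H+\Delta_k\right)=\det(H)+\sum_{i=1}^{k}v_i^T\operatorname{adj}\left(H+\Delta_{i-1}\right)u_i.$$
   Context: Here $\operatorname{adj}(M)$ denotes the adjugate (classical adjoint, i.e. transposed cofactor matrix) of a square matrix $M$, and the superscript $T$ denotes matrix transpose (without complex conjugation). The matrix $H$ is not assumed to be invertible. *)

(* Defs.v *)
From HB Require Import structures.
From mathcomp Require Import all_boot all_order all_algebra.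
Set Implicit Arguments.
Unset Strict Implicit.
Unset Printing Implicit Defensive.
Import GRing.Theory.
Local Open Scope ring_scope.

(** The vectors [u_1, ..., u_k] and [v_1, ..., v_k] are indexed
    from 0 by ['I_k], so [Delta u v i] is the sum of the first [i] products
    [u_j v_j^T]: it is the zero matrix for [i = 0], and for [i : 'I_k] it is the
    partial sum preceding the vectors [u i], [v i]. *)
Definition Delta (K : comNzRingType) (n k : nat) (u v : 'I_k -> 'cV[K]_n)
    (i : nat) : 'M[K]_n :=
  \sum_(j < k | (j < i)%N) u j *m (v j)^T.

(* Main.v *)
Require Import Defs.
From mathcomp Require Import all_boot all_order all_algebra.
From mathcomp Require Import reals complex.
Import GRing.Theory.
Local Open Scope ring_scope.
Local Open Scope complex_scope.

(** The sum telescopes: passing from [H + Delta u v i] to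
    [H + Delta u v i.+1] is a rank-one update, so everything follows from the
    matrix determinant lemma [det_rank1_update], in the adjugate form
    [det (A + u v^T) = det A + v^T (adj A) u], valid for singular [A] too.

    To prove the latter, the bordered matrix with blocks [A], [u], [- v^T], [1]
    has determinant [det (A + u v^T)], as clearing its last row shows. Clearing
    its last column instead requires dividing by [A]; doing it with
    [adj A] costs a factor [det A], and gives the formula multiplied by [det A]
    ([det_rank1_update_mul]). This factor can be cancelled once [A] is replaced
    by [A + X], whose determinant is a monic polynomial in [X]; evaluation at
    [X = 0] then gives the formula for [A]. This works over every commutative
    ring, so the real and the complex cases are two instances of one
    identity. *)

(** Both sides are [det A] times the determinant of the bordered matrix with
    blocks [A], [u], [- v^T], [1]: clearing its last row gives the left side,
    clearing its last column the right side. *)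
Lemma det_rank1_update_mul (K : comNzRingType) (n : nat) (A : 'M[K]_n)
    (u v : 'cV[K]_n) :
  \det A * \det (A + u *m v^T) =
  \det A * (\det A + (v^T *m \adj A *m u) 0 0).
Proof.
set d := \det A.
pose M := block_mx A u (- v^T) 1%:M.
have detM : \det M = \det (A + u *m v^T).
  have := det_mulmx M (block_mx 1%:M 0 v^T 1%:M).
  rewrite mulmx_block det_lblock !mulmx1 !mulmx0 mul1mx add0r addNr.
  by rewrite add0r det_ublock !det1 !mulr1 => <-.
(* The second block column of the right factor is A^-1 applied to - u, scaled
   by d to avoid the inverse. *)
have := det_mulmx M (block_mx 1%:M (- (\adj A *m u)) 0 d%:M).
rewrite mulmx_block mulmx1 !mulmx0 !addr0.
rewrite mulmxN mulmxA mul_mx_adj mul_mx_scalar mul_scalar_mx addNr.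
rewrite det_lblock det_ublock det1 mul1r det_scalar1 detM -/d.
rewrite mulNmx mulmxN opprK mul1mx det_mx11 mulmxA.
rewrite !mxE eqxx mulr1n => detE.
by rewrite mulrC -detE addrC.
Qed.

(** Holds because [det_rank1_update_mul] can be applied to [A + X] over the
    polynomial ring, where the extra factor is monic and hence regular, and
    then specialized to [X = 0]. *)
Lemma det_rank1_update (K : comNzRingType) (n : nat) (A : 'M[K]_n)
    (u v : 'cV[K]_n) :
  \det (A + u *m v^T) = \det A + (v^T *m \adj A *m u) 0 0.
Proof.
(* B is A + X, written as a characteristic matrix because the determinant of
   the latter is known to be monic. *)
pose B := char_poly_mx (- A).
pose up := map_mx polyC u; pose vp := map_mx polyC v.
have reg_detB : GRing.lreg (\det B) := monic_lreg (char_poly_monic (- A)).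
have /reg_detB/(congr1 (horner_eval 0)) := det_rank1_update_mul _ _ B up vp.
have evC m p (C : 'M[K]_(m, p)) : map_mx (horner_eval 0) (map_mx polyC C) = C.
  by apply/matrixP=> i j; rewrite !mxE /horner_eval hornerC.
have evB : map_mx (horner_eval 0) B = A.
  apply/matrixP=> i j; rewrite !mxE /horner_eval.
  by rewrite hornerD hornerN hornerMn hornerX hornerC mul0rn add0r opprK.
rewrite rmorphD -!det_map_mx map_mxD map_mxM map_trmx !evC evB => ->.
congr (_ + _).
transitivity (map_mx (horner_eval 0) (map_mx polyC v^T *m \adj B *m up) 0 0).
  by rewrite [RHS]mxE.
by rewrite !map_mxM map_mx_adj !evC evB.
Qed.

Lemma Delta0 (K : comNzRingType) (n k : nat) (u v : 'I_k -> 'cV[K]_n) :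
  Delta u v 0 = 0.
Proof. by rewrite /Delta big_pred0. Qed.

Lemma DeltaS (K : comNzRingType) (n k : nat) (u v : 'I_k -> 'cV[K]_n)
    (i : 'I_k) :
  Delta u v i.+1 = Delta u v i + u i *m (v i)^T.
Proof.
rewrite /Delta (bigD1 i) //= addrC; congr (_ + _).
by apply: eq_bigl => j; rewrite ltnS ltn_neqAle andbC.
Qed.

Lemma det_add_Delta (K : comNzRingType) (n k : nat) (H : 'M[K]_n)
    (u v : 'I_k -> 'cV[K]_n) :
  \det (H + Delta u v k) =
  \det H + \sum_(i < k) ((v i)^T *m \adj (H + Delta u v i) *m u i) 0 0.
Proof.
pose D i := \det (H + Delta u v i).
have step (i : 'I_k) :
    ((v i)^T *m \adj (H + Delta u v i) *m u i) 0 0 = D i.+1 - D i.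
  by rewrite /D DeltaS addrA det_rank1_update [RHS]addrC addKr.
rewrite (eq_bigr _ (fun i _ => step i)) -(big_mkord xpredT (fun i => D i.+1 - D i)).
by rewrite telescope_sumr // /D Delta0 addr0 [RHS]addrC subrK.
Qed.

Theorem lemma1 (R : realType) (n k : nat) (hn : (1 <= n)%N) (hk : (1 <= k)%N) :
  (forall (H : 'M[R]_n) (u v : 'I_k -> 'cV[R]_n),
     \det (H + Delta u v k) =
     \det H + \sum_(i < k) ((v i)^T *m \adj (H + Delta u v i) *m u i) 0 0)
  /\
  (forall (H : 'M[R[i]]_n) (u v : 'I_k -> 'cV[R[i]]_n),
     \det (H + Delta u v k) =
     \det H + \sum_(i < k) ((v i)^T *m \adj (H + Delta u v i) *m u i) 0 0).
Proof. by split=> H u v; apply: det_add_Delta. Qed.
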